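(* Let $G=(V,E)$ be a finite, connected, non-bipartite graph without multiple edges and self-loops, let $D$ be an integer such that $3\le D(x)\le D$ for all $x\in V$, where $D(x)$ is the degree of $x$, and let $\beta>0$. Assume that the spectrum of $P^2$ on $\ell^2_o(V,\pi)$ is contained in $[0,1-\beta]$. Then the spectrum of $\mathcal{S}^{*2}\mathcal{S}^2$ on $\ell^2_o(B,U)$ is contained in $[0,1-c(D,\beta)]$, where $c(D,\beta)$ is the positive number, depending only on $D$ and $\beta$, given with $Q=D-1$ by $$c(D,\beta)=\min\left(\frac{Q^{-4}\beta}{2(1+Q^{-4}\beta/6)^{2}},\;\frac{Q^{-4}\beta}{(1+6Q^4/\beta)^{2}}\right).$$
   Context: For vertices, $y\sim x$ means that $y$ is a neighbour of $x$. The measure $\pi$ on $V$ is $\pi(x)=D(x)$, and the operator $P$ on $\mathbb{C}^V$ is $Pf(x)=\frac{1}{D(x)}\sum_{y\sim x}f(y)$; it is self-adjoint on $\ell^2(V,\pi)$. $\ell^2_o(V,\pi)$ is the space of functions orthogonal to constants in $\ell^2(V,\pi)$; it is preserved by $P$. $B$ is the set of oriented edges of $G$ (each edge of $E$ gives two oriented edges), endowed with the uniform measure $U$ giving weight $1$ to each oriented edge. For $e\in B$, $o(e)$ is its origin and $t(e)$ its terminus. For $e,e'\in B$, $e'\leadsto e$ means that $t(e')=o(e)$ and $e$ is not the reverse of $e'$. The operator $\mathcal{S}$ on $\ell^2(B,U)$ is $\mathcal{S}f(e)=\frac{1}{D(o(e))-1}\sum_{e'\leadsto e}f(e')$, and $\mathcal{S}^*$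 is its adjoint on $\ell^2(B,U)$. $\ell^2_o(B,U)$ is the space of functions orthogonal to constants in $\ell^2(B,U)$; it is preserved by $\mathcal{S}$ and $\mathcal{S}^*$. *)

(* Defs.v *)
From HB Require Import structures.
From mathcomp Require Import all_boot all_order all_algebra.
From mathcomp Require Import complex.
From mathcomp Require Import boolp classical_sets functions set_interval reals.

Set Implicit Arguments.
Unset Strict Implicit.
Unset Printing Implicit Defensive.

Import Order.TTheory GRing.Theory Num.Theory.

Local Open Scope classical_set_scope.
Local Open Scope complex_scope.
Local Open Scope ring_scope.

Section WeightedL2.
Variables (R : realType) (X : finType) (w : X -> R).
Implicit Types (f g : {ffun X -> R[i]}) (T : {ffun X -> R[i]} -> {ffun X -> R[i]}).

Definition inner f g : R[i] := \sum_x (w x)%:C * f x * Num.conj (g x).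

Definition ell2o : set {ffun X -> R[i]} := [set f | inner f [ffun=> 1] = 0].

(* Since [inner (delta_x) h = w x * conj (h x)], the adjoint of T with respect
   to [inner] can only be given by this formula; see [adjointP]. *)
Definition adjoint T g : {ffun X -> R[i]} :=
  [ffun x => inner g (T [ffun y => (y == x)%:R]) / (w x)%:C].

(* The spectrum of the endomorphism of W induced by T (for W invariant under T).
   The spaces here are finite dimensional, so a bijective [T - l] automatically
   has a bounded inverse. *)
Definition spectrum T (W : set {ffun X -> R[i]}) : set R[i] :=
  [set l | ~ set_bij W W (fun f => T f - l *: f)].

Lemma adjointP T f g : linear T -> (forall x, 0 < w x) ->
  inner (T f) g = inner f (adjoint T g).
Proof.
move=> linT w_gt0; pose d x : {ffun X -> R[i]} := [ffun y => (y == x)%:R].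
have TD u v : T (u + v) = T u + T v.
  by have := linT 1 u v; rewrite !scale1r.
have T0 : T 0 = 0 by apply: (@addrI _ (T 0)); rewrite -TD !addr0.
have TZ a u : T (a *: u) = a *: T u.
  by have := linT a u 0; rewrite T0 !addr0.
have Tsum (F : X -> {ffun X -> R[i]}) : T (\sum_x F x) = \sum_x T (F x).
  exact: (big_morph T TD T0).
have -> : T f = \sum_x f x *: T (d x).
  have {1}-> : f = \sum_x f x *: d x.
    apply/ffunP => y; rewrite sum_ffunE (bigD1 y) //= big1 ?addr0.
      by rewrite !ffunE eqxx [RHS]mulr1.
    by move=> x; rewrite !ffunE eq_sym => /negPf ->; rewrite [LHS]mulr0.
  by rewrite Tsum; apply: eq_bigr => x _; rewrite TZ.
rewrite /inner.
under eq_bigr => y _ do rewrite sum_ffunE mulr_sumr mulr_suml.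
rewrite exchange_big /=; apply: eq_bigr => x _.
have wx0 : (w x)%:C != 0 by rewrite eq_complex /= eqxx andbT gt_eqF.
have -> : Num.conj (adjoint T g x) = Num.conj (inner g (T (d x))) / (w x)%:C.
  by rewrite ffunE rmorphM /= fmorphV; congr (_ / _); exact: conjc_real.
rewrite [(w x)%:C * f x]mulrC -[RHS]mulrA [X in _ * X]mulrCA divff // mulr1 /inner rmorph_sum mulr_sumr.
apply: eq_bigr => y _; rewrite !rmorphM /= conjCK !ffunE.
have -> : Num.conj (w y)%:C = (w y)%:C by exact: conjc_real.
by rewrite /GRing.scale /= [_ * (f x * _)]mulrCA -!mulrA [T _ _ * _]mulrC.
Qed.

End WeightedL2.

Definition spectrum_within (R : realType) (A : set R[i]) (a b : R) :=
  A `<=` [set r%:C | r in `[a, b]].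

Section Graph.
Variables (V : finType) (adj : rel V).

Definition degree (x : V) : nat := #|adj x|.

Definition connected_graph := forall x y, connect adj x y.

Definition bipartite :=
  exists A : {set V}, forall x y, adj x y -> (x \in A) != (y \in A).

Definition oedge := {p : V * V | adj p.1 p.2}.
HB.instance Definition _ := Finite.on oedge.

Definition origin (e : oedge) : V := (val e).1.
Definition terminus (e : oedge) : V := (val e).2.

Definition is_reverse (e e' : oedge) :=
  (origin e == terminus e') && (terminus e == origin e').

Definition follows (e' e : oedge) :=
  (terminus e' == origin e) && ~~ is_reverse e e'.

Variable R : realType.

Definition vertex_weight (x : V) : R := (degree x)%:R.
Definition edge_weight (_ : oedge) : R := 1.

Definition Pop (f : {ffun V -> R[i]}) : {ffun V -> R[i]} :=
  [ffun x => ((degree x)%:R)^-1 * \sum_(y | adj x y) f y].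

Definition Sop (f : {ffun oedge -> R[i]}) : {ffun oedge -> R[i]} :=
  [ffun e => ((degree (origin e))%:R - 1)^-1 * \sum_(e' | follows e' e) f e'].

Definition Sadj : {ffun oedge -> R[i]} -> {ffun oedge -> R[i]} :=
  adjoint edge_weight Sop.

Lemma Sop_linear : linear Sop.
Proof.
move=> a f g; apply/ffunP => e; rewrite !ffunE /GRing.scale /=.
under eq_bigr => e' _ do rewrite !ffunE.
by rewrite big_split /= -mulr_sumr mulrDr mulrCA.
Qed.

Lemma SadjP f g :
  inner edge_weight (Sop f) g = inner edge_weight f (Sadj g).
Proof. by apply: adjointP => [|e]; [exact: Sop_linear | exact: ltr01]. Qed.

End Graph.

Arguments vertex_weight {V} adj R x.
Arguments edge_weight {V} adj R _.
Arguments Pop {V} adj {R} f.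
Arguments Sop {V} adj {R} f.
Arguments Sadj {V} adj {R} f.

Definition gap_const (R : realType) (D : nat) (beta : R) : R :=
  let Q : R := D%:R - 1 in
  Num.min (Q ^- 4 * beta / (2 * (1 + Q ^- 4 * beta / 6) ^+ 2))
          (Q ^- 4 * beta / (1 + 6 * Q ^+ 4 / beta) ^+ 2).

(* Main.v *)
Require Import Defs.
From HB Require Import structures.
From mathcomp Require Import all_boot all_order all_algebra complex.
From mathcomp Require Import ring lra.
From mathcomp Require Import boolp classical_sets functions set_interval reals.

(* Decompose a function f on oriented edges as f = m o t + g, where m is its
   average over the edges pointing to a given vertex and g = osc f has zero
   average at every vertex. Up to reversal of edges, S f is
   m o t - g / (D o t - 1), and D - 1 >= 2, so that
   |S f|^2 <= |f|^2 - 3/4 |osc f|^2. The reversal of m o t is a function of the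
   origin, whose average is P m, so its oscillating part has squared norm
   |m|^2 - |P m|^2 >= beta |m|^2; adding the term coming from g,
   |m|^2 - |P m|^2 <= 2 |osc (S f)|^2 + 1/2 |osc f|^2. The first bound applied
   to f and to S f now yields |f|^2 - |S^2 f|^2 >= (3 beta / 8) |f|^2 unless
   m = 0 (which holds if beta > 1), when the loss is at least 3/4 |f|^2. *)

Set Implicit Arguments.
Unset Strict Implicit.
Unset Printing Implicit Defensive.

Import Order.TTheory GRing.Theory Num.Theory.
Local Open Scope ring_scope.

(** * Eigenvectors in invariant subspaces *)

Lemma stable_subspace_eigenvector (C : numClosedFieldType) (vT : vectType C) (T : 'End(vT))
  (U : {vspace vT}) : (T @: U <= U)%VS -> U != 0%VS ->
  exists l v, [/\ v \in U, v != 0 & T v = l *: v].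
Proof.
move=> TU U0.
pose n := \dim {: subvs_of U}.
have n_gt0 : (0 < n)%N by rewrite /n dimvf lt0n dimv_eq0.
(* [phi] is [T] restricted to [U]. Its matrix has positive size, so it has an eigenvalue over an
   algebraically closed field. *)
pose phi : 'End(subvs_of U) := linfun (vsproj U \o T \o vsval).
have bas := vbasisP {: subvs_of U}.
have [l] := eigenvalue_closed (passmx.mxof (vbasis _) (vbasis _) phi) n_gt0.
rewrite /eigenvalue -(passmx.vsof_eq0 bas) -passmx.leigenspaceE // -vpick0 => v0.
have := memv_pick (passmx.leigenspace phi l); move: v0.
set v := vpick _ => v0.
rewrite memv_ker !lfunE /= !lfunE /= subr_eq0 lfunE /= => /eqP /(congr1 vsval).
rewrite vsprojK ?(subvP TU) ?memv_img ?subvsP // => Tv.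
exists l, (vsval v); split=> //; first exact: subvsP.
by rewrite Tv lfunE.
Qed.

(** * Weighted inner products, Rayleigh bounds and spectra *)

Section WeightedL2Theory.
Variables (R : realType) (X : finType) (w : X -> R).
Hypothesis w_gt0 : forall x, 0 < w x.
Local Notation C := R[i].
(* The library makes {ffun X -> W} a vectType over R[i] only when W is
   syntactically one, which R[i]^o is but R[i] is not. *)
Local Notation ell2 := {ffun X -> R[i]^o}.
Implicit Types f g h : {ffun X -> R[i]}.

Lemma innerDl f g h : inner w (f + g) h = inner w f h + inner w g h.
Proof. by rewrite -big_split; apply: eq_bigr => x _; rewrite !ffunE mulrDr mulrDl. Qed.

Lemma innerZl a f h : inner w (a *: f) h = a * inner w f h.
Proof.
rewrite mulr_sumr; apply: eq_bigr => x _.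
by rewrite !ffunE [a *: _](erefl (a * f x)) mulrCA !mulrA.
Qed.

Lemma inner_conj f g : Num.conj (inner w f g) = inner w g f.
Proof.
rewrite rmorph_sum; apply: eq_bigr => x _; rewrite !rmorphM /= conjCK.
rewrite -[X in _ = X]mulrA (mulrC (g x)) mulrA.
by have -> : Num.conj (w x)%:C%C = (w x)%:C%C by exact: conjc_real.
Qed.

Lemma innerDr f g h : inner w h (f + g) = inner w h f + inner w h g.
Proof. by rewrite -inner_conj innerDl rmorphD /= !inner_conj. Qed.

Lemma innerZr a f h : inner w h (a *: f) = Num.conj a * inner w h f.
Proof. by rewrite -inner_conj innerZl rmorphM /= inner_conj. Qed.

Lemma innerBl f g h : inner w (f - g) h = inner w f h - inner w g h.
Proof. by rewrite -scaleN1r innerDl innerZl mulN1r. Qed.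

Definition sqnorm f : R := \sum_x w x * (complex.Re (f x) ^+ 2 + complex.Im (f x) ^+ 2).

Lemma inner_sqnorm f : inner w f f = (sqnorm f)%:C%C.
Proof.
rewrite /inner /sqnorm rmorph_sum; apply: eq_bigr => x _ /=.
by rewrite -mulrA -normCK rmorphM -add_Re2_Im2.
Qed.

Let term_ge0 f x : 0 <= w x * (complex.Re (f x) ^+ 2 + complex.Im (f x) ^+ 2).
Proof. by rewrite pmulr_rge0 // addr_ge0 ?sqr_ge0. Qed.

Lemma sqnorm_ge0 f : 0 <= sqnorm f.
Proof. by apply: sumr_ge0 => x _; apply: term_ge0. Qed.

Lemma sqnorm_eq0 f : (sqnorm f == 0) = (f == 0).
Proof.
apply/idP/eqP => [|->]; last first.
  by apply/eqP/big1 => x _; rewrite !ffunE /= expr0n addr0 mulr0.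
rewrite psumr_eq0 => [/allP f0|x _]; last exact: term_ge0.
apply/ffunP => x; have := f0 x (mem_index_enum x).
rewrite ffunE /= mulf_eq0 gt_eqF //= paddr_eq0 ?sqr_ge0 // !sqrf_eq0.
by case: (f x) => a b /= /andP[/eqP-> /eqP->].
Qed.

Definition inner_left h (f : ell2) : C^o := inner w f h.

Lemma inner_left_linear h : linear (inner_left h).
Proof. by move=> a f g; rewrite /inner_left innerDl innerZl. Qed.

HB.instance Definition _ h :=
  GRing.isLinear.Build _ _ _ _ (inner_left h) (inner_left_linear h).

(** The orthogonal complement of [h], as a kernel so that dimension arguments apply; for [h]
    constant equal to 1 it is [ell2o]. *)
Definition orthov h : {vspace ell2} := lker (linfun (inner_left h)).

Lemma mem_orthov f h : ((f : ell2) \in orthov h) = (inner w f h == 0).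
Proof. by rewrite memv_ker lfunE. Qed.

(** Induction on the dimension of [U]: split off an eigenvector [v]. By symmetry [T] preserves the
    complement of [v] in [U], and the quadratic form has no cross terms. *)
Lemma rayleigh_bound (T : 'End(ell2)) (U : {vspace ell2}) (b : R) :
  (forall f g, inner w (T f) g = inner w f (T g)) -> (T @: U <= U)%VS ->
  (forall f l, (f : ell2) \in U -> f != 0 -> T f = l *: f -> l <= b%:C%C) ->
  forall f, (f : ell2) \in U -> inner w (T f) f <= b%:C%C * inner w f f.
Proof.
move=> Tsym; have [n] := ubnP (\dim U); elim: n U => // n IHn U dimU TU eigU f fU.
have [U0|U0] := eqVneq U 0%VS.
  move: fU; rewrite U0 memv0 => /eqP ->; rewrite linear0.
  by rewrite (_ : inner w 0 0 = 0) ?mulr0 // -(scale0r 0) innerZl mul0r.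
have [l [v [vU v0 Tv]]] := stable_subspace_eigenvector TU U0.
pose U' := (U :&: orthov v)%VS.
have vv0 : inner w v v != 0 by rewrite inner_sqnorm fmorph_eq0 sqnorm_eq0.
have dimU' : (\dim U' < n)%N.
  apply: leq_trans (_ : \dim U <= n)%N; last by [].
  rewrite (ltn_leqif (dimv_leqif_sup (capvSl _ _))).
  (* The dimension drops because [v] lies in [U] but is not orthogonal to itself. *)
  by apply: contra vv0 => /subvP/(_ v vU); rewrite memv_cap mem_orthov => /andP[].
pose a := inner w f v / inner w v v; pose g := f - a *: v.
have gv : inner w g v = 0 by rewrite innerBl innerZl divfK // subrr.
have vg : inner w v g = 0 by rewrite -inner_conj gv rmorph0.
have gU' : (g : ell2) \in U' by rewrite memv_cap mem_orthov gv eqxx rpredB // rpredZ.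
have TU' : (T @: U' <= U')%VS.
  apply/subvP => _ /memv_imgP[h + ->]; rewrite !memv_cap => /andP[hU].
  rewrite !mem_orthov => /eqP hv; rewrite (subvP TU) ?memv_img //= Tsym Tv.
  by rewrite innerZr hv mulr0.
have Tgg : inner w (T g) g <= b%:C%C * inner w g g.
  by apply: IHn gU' => // h c /memv_capP[hU _]; apply: eigU.
have -> : f = a *: v + g by rewrite addrC subrK.
clearbody g; rewrite linearD linearZ /= Tv.
rewrite !(innerDl, innerDr, innerZl, innerZr) gv vg.
rewrite !mulr0 addr0 add0r Tsym Tv innerZr gv !mulr0 add0r addr0 mulrDr lerD //.
(* What remains is the component along [v]: the nonnegative number [|a|^2 * inner w v v] multiplied
   by [l] or by [b]. *)
rewrite mulrCA mulrA -mulrA; apply: ler_wpM2r; last exact: eigU Tv.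
by rewrite mulrA -normCK mulr_ge0 ?exprn_ge0 // inner_sqnorm ler0c sqnorm_ge0.
Qed.

Lemma eigenvector_spectrum (T : ell2 -> ell2) f l : T 0 = 0 ->
  ell2o w f -> f != 0 -> T f = l *: f -> spectrum T (ell2o w) l.
Proof.
move=> T0 Wf f0 Tf [_ inj _]; case/eqP: f0; apply: inj; rewrite ?inE //.
  by rewrite /ell2o /= -(scale0r 0) innerZl mul0r.
by rewrite Tf T0 scaler0 !subrr.
Qed.

(** In finite dimension, if [T - l] is injective on the invariant space, then it is also surjective
    there by rank-nullity; so a spectral value must have an eigenvector. *)
Lemma spectrum_eigenvector (T : ell2 -> ell2) l : linear T ->
  (forall f, ell2o w f -> ell2o w (T f)) -> spectrum T (ell2o w) l ->
  exists f, [/\ ell2o w f, f != 0 & T f = l *: f].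
Proof.
move=> linT TW spec_l; apply: contrapT => no_eig; apply: spec_l.
pose Tl : {linear ell2 -> ell2} := HB.pack T (GRing.isLinear.Build _ _ _ _ T linT).
pose F : 'End(ell2) := linfun Tl - l *: \1%VF.
pose W := orthov [ffun=> 1].
have WP f : reflect (ell2o w f) (f \in W).
  by rewrite mem_orthov; apply: eqP.
have FE f : F f = T f - l *: f.
  by rewrite add_lfunE opp_lfunE scale_lfunE id_lfunE (lfunE Tl).
have kerF f : (f \in lker F) = (F f == 0) := memv_ker F f.
clearbody W F.
have FW : (F @: W <= W)%VS.
  apply/subvP => _ /memv_imgP[f /WP fW ->].
  by rewrite FE; apply: rpredB; [apply/WP/TW | apply: rpredZ; apply/WP].
have capW : (W :&: lker F = 0)%VS.
  apply/eqP; rewrite -subv0; apply/subvP => f; rewrite memv_cap kerF FE subr_eq0 memv0.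
  by case/andP=> /WP fW /eqP Tf; apply/negPn/negP => f0; apply: no_eig; exists f.
have imW : (F @: W = W)%VS by apply/eqP; rewrite eqEdim FW limg_dim_eq ?leqnn.
split.
- by move=> f /WP fW; apply/WP; rewrite -FE (subvP FW) // memv_img.
- move=> f g; rewrite !inE => /WP fW /WP gW; rewrite -!FE => Ffg.
  have Fd : F (f - g) = F f - F g := linearB F f g.
  have : (f - g : ell2) \in (W :&: lker F)%VS.
    by rewrite memv_cap kerF Fd Ffg subrr eqxx andbT rpredB.
  by rewrite capW memv0 subr_eq0 => /eqP.
- move=> f /WP; rewrite -{1}imW => /memv_imgP[g /WP gW ->].
  by exists g => //; rewrite FE.
Qed.

Lemma spectrum_within_rayleigh (T : ell2 -> ell2) (a b : R) : linear T ->
  (forall f g, inner w (T f) g = inner w f (T g)) ->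
  (forall f, ell2o w f -> ell2o w (T f)) ->
  spectrum_within (spectrum T (ell2o w)) a b ->
  forall f, ell2o w f -> inner w (T f) f <= b%:C%C * inner w f f.
Proof.
move=> linT Tsym TW specT f Wf.
pose Tl : {linear ell2 -> ell2} := HB.pack T (GRing.isLinear.Build _ _ _ _ T linT).
have WP g : reflect (ell2o w g) ((g : ell2) \in orthov [ffun=> 1]).
  by rewrite mem_orthov; apply: eqP.
rewrite -[T f](lfunE Tl); apply: (rayleigh_bound (U := orthov [ffun=> 1])).
- by move=> g h; rewrite !(lfunE Tl) Tsym.
- by apply/subvP => _ /memv_imgP[g /WP gW ->]; rewrite (lfunE Tl); apply/WP/TW.
- move=> g l /WP Wg g0; rewrite (lfunE Tl) => Tg.
  have T0 : T 0 = 0 := linear0 Tl.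
  have [r /= + <-] := specT _ (eigenvector_spectrum T0 Wg g0 Tg).
  by rewrite lecR in_itv /= => /andP[].
- exact/WP.
Qed.

Lemma sqnormDo f g : inner w f g = 0 -> sqnorm (f + g) = sqnorm f + sqnorm g.
Proof.
move=> fg; apply: complexI; rewrite rmorphD /= -!inner_sqnorm innerDl !innerDr fg.
by rewrite -(inner_conj f g) fg rmorph0 addr0 add0r.
Qed.

Lemma sqnormN f : sqnorm (- f) = sqnorm f.
Proof. by apply: eq_bigr => x _; rewrite !ffunE; case: (f x) => a b /=; rewrite !sqrrN. Qed.

Lemma sqnorm_le_sub f g : sqnorm f <= 2 * sqnorm (f - g) + 2 * sqnorm g.
Proof.
rewrite !mulr_sumr -big_split; apply: ler_sum => x _ /=.
rewrite !(mulrCA 2) -mulrDr ler_pM2l // !ffunE.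
case: (f x) (g x) => a b [c d] /=.
(* The right side minus the left is exactly [(a - 2c)^2 + (b - 2d)^2]. *)
by have := sqr_ge0 (a - 2 * c); have := sqr_ge0 (b - 2 * d); nra.
Qed.
End WeightedL2Theory.

(** * Numerical bounds on the gap constant *)

Lemma gap_const_bounds (R : realType) (D : nat) (beta : R) : (3 <= D)%N -> 0 < beta ->
  [/\ 0 < gap_const D beta, gap_const D beta <= beta / 32 & gap_const D beta <= 3 / 4].
Proof.
move=> D3 beta0; rewrite /gap_const.
set Q : R := D%:R - 1; set s := Q ^- 4 * beta.
have Q2 : 2 <= Q by rewrite lerBrDr natr1 ler_nat.
have Q4 : 16 <= Q ^+ 4.
  by apply: le_trans (lerXn2r 4 _ _ Q2); rewrite ?nnegrE //; lra.
have s0 : 0 < s by rewrite mulr_gt0 // invr_gt0; lra.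
have s16 : s <= beta / 16.
  rewrite [s]mulrC ler_pM2l // lef_pV2 ?posrE //; lra.
have d1 : 1 <= (1 + s / 6) ^+ 2 by nra.
(* This follows from [(1 + s/6)^2 - (1 - s/6)^2 = 2s/3]. It bounds the first term of the minimum by
   3/4, while [s16] and [d1] bound it by [beta / 32]. *)
have ds : s <= 3 / 2 * (1 + s / 6) ^+ 2.
  by have := sqr_ge0 (1 - s / 6); nra.
have bd : beta <= beta * (1 + s / 6) ^+ 2 by rewrite ler_peMr // ltW.
split.
- have Qb : 0 < 6 * Q ^+ 4 / beta by rewrite divr_gt0 //; lra.
  rewrite lt_min; apply/andP; split; apply: divr_gt0 => //; first lra.
  by rewrite exprn_gt0 //; lra.
- by rewrite ge_min ler_pdivrMr; [apply/orP; left; lra | lra].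
- by rewrite ge_min ler_pdivrMr; [apply/orP; left; lra | lra].
Qed.

(** * Oriented edges and the non-backtracking operator *)

Section NonBacktracking.
Variables (R : realType) (V : finType) (adj : rel V).
Hypothesis adj_sym : symmetric adj.
Hypothesis deg_ge3 : forall x : V, (3 <= degree adj x)%N.
Local Notation C := R[i].
Local Notation oedge := (oedge adj).
Local Notation eip := (inner (edge_weight adj R)).
Local Notation vip := (inner (vertex_weight adj R)).
Local Notation esq := (sqnorm (edge_weight adj R)).
Local Notation vsq := (sqnorm (vertex_weight adj R)).
Local Notation term := (@terminus V adj).
Local Notation orig := (@origin V adj).
Local Notation deg x := ((degree adj x)%:R : C).
Implicit Types (f g h : {ffun oedge -> C}) (phi psi : {ffun V -> C}) (e : oedge) (x y : V).

Definition rev_edge e : oedge :=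
  exist _ ((val e).2, (val e).1) (etrans (adj_sym _ _) (valP e)).

Lemma term_rev e : term (rev_edge e) = orig e. Proof. by []. Qed.

Lemma rev_edgeK : involutive rev_edge.
Proof. by move=> e; apply: val_inj => /=; case: (val e). Qed.

Lemma sum_into (F : V -> C) x :
  \sum_(e : oedge | term e == x) F (orig e) = \sum_(y | adj x y) F y.
Proof.
(* Edges into [x] correspond to neighbours [y] of [x] through [y -> (y, x)], a partial map because
   the pair must be an edge. *)
rewrite [RHS](reindex_omap (fun e : oedge => orig e)
   (fun y => if insub (y, x) is Some e then Some e else None)) /=; last first.
  move=> y; rewrite adj_sym => yx; rewrite insubT //=.
apply: eq_bigl => e; apply/eqP/andP => [<-|[xy]].
  split; first by rewrite adj_sym; apply: (valP e).
  by rewrite -surjective_pairing valK.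
case: insubP => /= [u _ uE /eqP[<-]|]; last by [].
exact: (congr1 snd uE).
Qed.

Lemma card_into x : \sum_(e : oedge | term e == x) 1 = deg x.
Proof. by rewrite (sum_into (fun=> 1)) sumr_const. Qed.

Lemma deg_neq0 x : deg x != 0.
Proof. by rewrite pnatr_eq0 -lt0n (leq_trans _ (deg_ge3 x)). Qed.

Definition lift phi : {ffun oedge -> C} := [ffun e => phi (term e)].
(** Both the adjoint of [lift] ([eip_lift]) and a left inverse of it ([mean_lift]), so
    [lift (mean f)] is the orthogonal projection of [f] onto functions of the terminus. *)
Definition mean f : {ffun V -> C} :=
  [ffun x => (deg x)^-1 * \sum_(e | term e == x) f e].
Definition osc f := f - lift (mean f).
Definition flip f : {ffun oedge -> C} := [ffun e => f (rev_edge e)].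
Definition damp f : {ffun oedge -> C} := [ffun e => (deg (term e) - 1)^-1 * f e].

Lemma edge_weight_gt0 e : 0 < edge_weight adj R e.
Proof. exact: ltr01. Qed.

Lemma eipE f g : eip f g = \sum_e f e * Num.conj (g e).
Proof. by apply: eq_bigr => e _; rewrite mul1r. Qed.

(** Group the edges by terminus; the vertex weight cancels the inverse degree in [mean]. *)
Lemma eip_lift f psi : eip f (lift psi) = vip (mean f) psi.
Proof.
rewrite eipE (partition_big term predT) //=; apply: eq_bigr => x _.
rewrite ffunE /vertex_weight rmorph_nat mulrA divff ?deg_neq0 // mul1r mulr_suml.
by apply: eq_bigr => e /eqP <-; rewrite ffunE.
Qed.

Lemma mean_lift phi : mean (lift phi) = phi.
Proof.
apply/ffunP => x; rewrite ffunE.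
under eq_bigr => e /eqP ex do rewrite ffunE ex -[phi x]mul1r.
by rewrite -mulr_suml card_into mulrA mulVf ?deg_neq0 // mul1r.
Qed.

Lemma meanB f g : mean (f - g) = mean f - mean g.
Proof.
apply/ffunP => x; rewrite !ffunE -mulrBr -sumrB; congr (_ * _).
by apply: eq_bigr => e _; rewrite !ffunE.
Qed.

Lemma mean_osc f : mean (osc f) = 0.
Proof. by rewrite /osc meanB mean_lift subrr. Qed.

Lemma mean_damp f : mean f = 0 -> mean (damp f) = 0.
Proof.
move=> f0; apply/ffunP => x; rewrite !ffunE.
under eq_bigr => e /eqP ex do rewrite ffunE ex.
rewrite -mulr_sumr mulrCA.
by have /ffunP/(_ x) := f0; rewrite !ffunE => ->; rewrite mulr0.
Qed.

(** The bridge to the vertices: a reversed lift depends only on the origin, and the origins of the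
    edges into [x] are the neighbours of [x]. *)
Lemma mean_flip_lift phi : mean (flip (lift phi)) = Pop adj phi.
Proof.
apply/ffunP => x; rewrite !ffunE -sum_into; congr (_ * _).
by apply: eq_bigr => e _; rewrite !ffunE.
Qed.

Lemma eip_flip f g : eip (flip f) (flip g) = eip f g.
Proof.
rewrite !eipE [RHS](reindex_inj (inv_inj rev_edgeK)).
by apply: eq_bigr => e _; rewrite !ffunE.
Qed.

Lemma flipK : involutive flip.
Proof. by move=> f; apply/ffunP => e; rewrite !ffunE rev_edgeK. Qed.

Lemma flipB f g : flip (f - g) = flip f - flip g.
Proof. by apply/ffunP => e; rewrite !ffunE. Qed.

Lemma esq_flip f : esq (flip f) = esq f.
Proof. by apply: complexI; rewrite /= -!inner_sqnorm eip_flip. Qed.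

Lemma esq_lift phi : esq (lift phi) = vsq phi.
Proof. by apply: complexI; rewrite /= -!inner_sqnorm eip_lift mean_lift. Qed.

Lemma esqD_lift phi g : mean g = 0 -> esq (lift phi + g) = vsq phi + esq g.
Proof.
move=> g0; rewrite sqnormDo ?esq_lift // -inner_conj eip_lift g0.
by rewrite -(scale0r 0) innerZl mul0r rmorph0.
Qed.

Lemma esq_osc f : esq f = vsq (mean f) + esq (osc f).
Proof. by rewrite -esqD_lift ?mean_osc // addrC subrK. Qed.

(** The predecessors of [e] are all the edges into its origin except its reverse. With [m] the mean
    there, [d] the degree and [g] the oscillation at the reverse edge, the value is [(d m - (m + g))
    / (d - 1) = m - g / (d - 1)]. *)
Lemma Sop_flip f : Sop adj f = flip (lift (mean f) - damp (osc f)).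
Proof.
apply/ffunP => e; rewrite !ffunE term_rev.
have -> : \sum_(e' | follows e' e) f e' =
    \sum_(e' | term e' == orig e) f e' - f (rev_edge e).
  rewrite [in RHS](bigD1 (rev_edge e)) ?term_rev //= addrAC subrr add0r.
  apply: eq_bigl => e'; rewrite /follows /is_reverse; case: eqP => //= te.
  rewrite te eqxx /=; congr (~~ _); apply/eqP/eqP => [oe|->]; last by [].
  by apply: val_inj; rewrite [LHS]surjective_pairing; congr (_, _).
set s := \sum_(_ | _) _; set a := f _; set d := deg _.
have d0 : d != 0 by apply: deg_neq0.
have d1 : d - 1 != 0.
  by rewrite subr_eq0 pnatr_eq1 gtn_eqF // (leq_trans _ (deg_ge3 _)).
by field; rewrite d0.
Qed.

Lemma esq_damp f : esq (damp f) <= 4^-1 * esq f.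
Proof.
rewrite mulr_sumr; apply: ler_sum => e _; rewrite !mul1r ffunE.
have d2 : 2 <= (degree adj (term e))%:R - 1 :> R.
  by rewrite lerBrDr natr1 ler_nat.
have -> : (deg (term e) - 1)^-1 = (((degree adj (term e))%:R - 1 : R)^-1)%:C%C.
  by rewrite fmorphV rmorphB rmorph_nat rmorph1.
set d : R := _ - 1 in d2 *; case: (f e) => a b /=.
have di : d^-1 <= 2^-1 by rewrite lef_pV2 // posrE; lra.
have di0 : 0 < d^-1 by rewrite invr_gt0; lra.
rewrite !mul0r subr0 addr0 !exprMn -mulrDr ler_wpM2r ?addr_ge0 ?sqr_ge0 //.
by rewrite expr2; nra.
Qed.

(** [flip] is an isometry, and the two terms of [Sop_flip] are orthogonal since damping keeps the
    mean zero. *)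
Lemma esq_Sop f : esq (Sop adj f) <= vsq (mean f) + 4^-1 * esq (osc f).
Proof.
rewrite Sop_flip esq_flip esqD_lift ?sqnormN ?lerD2l ?esq_damp //.
rewrite -(sub0r (damp _)) meanB mean_damp ?mean_osc // subr0 -(mean_lift 0).
by congr mean; apply/ffunP => e; rewrite !ffunE.
Qed.

Lemma esq_osc_Sop f : vsq (mean f) - vsq (Pop adj (mean f)) <=
  2 * esq (osc (Sop adj f)) + 2^-1 * esq (osc f).
Proof.
set phi := mean f.
have -> : vsq phi - vsq (Pop adj phi) = esq (osc (flip (lift phi))).
  apply/eqP; rewrite subr_eq addrC -mean_flip_lift -esq_osc esq_flip esq_lift //.
have oscB g h : osc (g - h) = osc g - osc h.
  by rewrite /osc meanB; apply/ffunP => e; rewrite !ffunE; ring.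
(* The difference of these two functions is [osc (Sop adj f)]; the second has squared norm at most a
   quarter of that of [osc f], whence the coefficient 1/2. *)
have := sqnorm_le_sub edge_weight_gt0 (osc (flip (lift phi)))
  (osc (flip (damp (osc f)))).
rewrite -oscB -flipB -Sop_flip => le_osc.
have := esq_osc (flip (damp (osc f))); rewrite esq_flip.
have : 0 <= vsq (mean (flip (damp (osc f)))).
  by rewrite -esq_lift sqnorm_ge0 //; apply: edge_weight_gt0.
have := esq_damp (osc f); lra.
Qed.

(** * Symmetry, linearity and preservation of the complements of constants *)

Lemma vertex_weight_gt0 x : 0 < vertex_weight adj R x.
Proof. by rewrite ltr0n (leq_trans _ (deg_ge3 x)). Qed.

Lemma lift_cst (c : C) : lift [ffun=> c] = [ffun=> c].
Proof. by apply/ffunP => e; rewrite !ffunE. Qed.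

Lemma flip_cst (c : C) : flip [ffun=> c] = [ffun=> c].
Proof. by apply/ffunP => e; rewrite !ffunE. Qed.

Lemma ell2o_mean f : ell2o (edge_weight adj R) f <-> ell2o (vertex_weight adj R) (mean f).
Proof. by rewrite /ell2o /= -(lift_cst 1) eip_lift. Qed.

Lemma Pop_linear : linear (Pop adj : {ffun V -> C} -> {ffun V -> C}).
Proof.
move=> a phi psi; apply/ffunP => x; rewrite !ffunE /GRing.scale /=.
under eq_bigr => y _ do rewrite !ffunE.
by rewrite big_split /= -mulr_sumr mulrDr mulrCA.
Qed.

(** [P] is [mean] after [flip] after [lift], where [mean] and [lift] are adjoint and [flip] is an
    isometric involution. *)
Lemma Pop_sym phi psi : vip (Pop adj phi) psi = vip phi (Pop adj psi).
Proof.
rewrite -!mean_flip_lift -eip_lift -[lift psi]flipK eip_flip.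
by rewrite flipK -inner_conj eip_lift inner_conj.
Qed.

Lemma ell2o_Pop phi : ell2o (vertex_weight adj R) phi ->
  ell2o (vertex_weight adj R) (Pop adj phi).
Proof.
by rewrite /ell2o /= Pop_sym -mean_flip_lift lift_cst flip_cst -(lift_cst 1) mean_lift.
Qed.

Lemma ell2o_Sop f : ell2o (edge_weight adj R) f -> ell2o (edge_weight adj R) (Sop adj f).
Proof.
move=> /ell2o_mean f0; rewrite /ell2o /= Sop_flip -flip_cst eip_flip.
by rewrite -lift_cst eip_lift meanB mean_lift mean_damp ?mean_osc ?subr0.
Qed.

Lemma Sop1 : Sop adj [ffun=> 1 : C] = [ffun=> 1].
Proof.
rewrite Sop_flip -(lift_cst 1) /osc mean_lift subrr; apply/ffunP => e.
by rewrite !ffunE mulr0 subr0.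
Qed.

Lemma Sadj_inner f g : eip (Sadj adj f) g = eip f (Sop adj g).
Proof. by rewrite -inner_conj -SadjP inner_conj. Qed.

Lemma ell2o_Sadj f : ell2o (edge_weight adj R) f -> ell2o (edge_weight adj R) (Sadj adj f).
Proof. by rewrite /ell2o /= Sadj_inner Sop1. Qed.

Lemma Sadj_linear : linear (Sadj adj : {ffun oedge -> C} -> {ffun oedge -> C}).
Proof.
move=> a f g; apply/ffunP => e; rewrite !ffunE innerDl innerZl mulrDl.
by rewrite -mulrA.
Qed.

(** By symmetry the squared norm of [P phi] is the quadratic form of [P^2] at [phi], to which the
    Rayleigh bound applies. *)
Lemma vsq_Pop_gap (b : R) :
  spectrum_within (spectrum (Pop adj \o Pop adj) (ell2o (vertex_weight adj R))) 0 b ->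
  forall phi, ell2o (vertex_weight adj R) phi -> vsq (Pop adj phi) <= b * vsq phi.
Proof.
move=> specP phi phi0; rewrite -lecR rmorphM /= -!inner_sqnorm -Pop_sym.
apply: (spectrum_within_rayleigh vertex_weight_gt0 _ _ _ specP) => //.
- by move=> a f g /=; rewrite !Pop_linear.
- by move=> f g; rewrite /= !Pop_sym.
- by move=> f f0; apply/ell2o_Pop/ell2o_Pop.
Qed.

Lemma esq_Sop2_gap (beta k : R) f :
  vsq (Pop adj (mean f)) <= (1 - beta) * vsq (mean f) ->
  k <= beta / 32 -> k <= 3 / 4 ->
  esq (Sop adj (Sop adj f)) <= (1 - k) * esq f.
Proof.
move=> gapP kb k34.
have := esq_Sop (Sop adj f); have := esq_osc (Sop adj f).
have := esq_osc_Sop f; have := esq_Sop f; rewrite (esq_osc f).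
have : 0 <= esq (osc (Sop adj f)) by apply: sqnorm_ge0; apply: edge_weight_gt0.
have : 0 <= esq (osc f) by apply: sqnorm_ge0; apply: edge_weight_gt0.
have : 0 <= vsq (Pop adj (mean f)) by apply: sqnorm_ge0; apply: vertex_weight_gt0.
have : 0 <= vsq (mean f) by apply: sqnorm_ge0; apply: vertex_weight_gt0.
move: gapP; set P := vsq (Pop _ _); set M := vsq (mean f); set b := esq (osc f).
set c := esq (osc _) => PM M0 P0 b0 c0 e1 e2.
rewrite -/b -/c => e3 e4.
(* If [M = 0], the squared norm of [S^2 f] is at most [b / 4], so [k <= 3/4] suffices. *)
have [M0'|M_gt0] := leP M 0.
  have {M0 M0'}M0 : M = 0 by apply/eqP; rewrite eq_le M0 M0'.
  by rewrite M0 in PM e1 e2 *; have := ler_wpM2r b0 k34; lra.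
(* Here [0 <= P <= (1 - beta) * M] with [M > 0]. *)
have beta1 : beta <= 1 by rewrite -subr_ge0 -(pmulr_lge0 _ M_gt0) (le_trans P0).
(* Eliminating [c] bounds the squared norm of [S^2 f] by [(1 - 3 beta / 8) M + (7/16) b], and
   [k <= beta / 32 <= 1/32]. *)
have := ler_wpM2r M0 kb; have := ler_wpM2r b0 kb; have := ler_wpM2r b0 beta1; lra.
Qed.
End NonBacktracking.

Theorem theorem1p1 (R : realType) (V : finType) (adj : rel V)
    (adj_sym : symmetric adj) (adj_irr : irreflexive adj)
    (G_connected : connected_graph adj) (G_nonbipartite : ~ bipartite adj)
    (D : nat) (degD : forall x : V, (3 <= degree adj x <= D)%N)
    (beta : R) (beta_gt0 : 0 < beta)
    (P_gap : spectrum_within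
       (spectrum (Pop adj \o Pop adj) (ell2o (vertex_weight adj R)))
       0 (1 - beta)) :
  0 < gap_const D beta /\
  spectrum_within
    (spectrum (Sadj adj \o Sadj adj \o Sop adj \o Sop adj)
              (ell2o (edge_weight adj R)))
    0 (1 - gap_const D beta).
Proof.
have deg3 x : (3 <= degree adj x)%N by case/andP: (degD x).
have D3 : (3 <= D)%N.
  (* Any vertex gives [3 <= D]; a graph without vertices would be bipartite. *)
  have [x _|V0] := pickP (mem V); first by case/andP: (degD x); apply: leq_trans.
  by case: G_nonbipartite; exists finset.set0 => x; have := V0 x.
have [k0 kb k34] := gap_const_bounds D3 beta_gt0; split=> // l.
move=> /spectrum_eigenvector[].
- by move=> a f g /=; rewrite !Sop_linear !Sadj_linear.
- move=> f f0 /=; do 2 apply: ell2o_Sadj => //; do 2 apply: ell2o_Sop => //.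
move=> f [f0 f_neq0 /= Tf].
have f_gt0 : 0 < sqnorm (edge_weight adj R) f.
  by rewrite lt_def sqnorm_eq0 ?f_neq0 ?sqnorm_ge0 //; apply: edge_weight_gt0.
(* Pairing the eigenvector equation with [f] and moving both adjoints across shows that [l] is this
   Rayleigh quotient, hence real and nonnegative. *)
exists (sqnorm (edge_weight adj R) (Sop adj (Sop adj f)) /
        sqnorm (edge_weight adj R) f).
  rewrite /= in_itv /= divr_ge0 ?sqnorm_ge0 //=; try exact: edge_weight_gt0.
  rewrite ler_pdivrMr //; apply: esq_Sop2_gap kb k34 => //.
  by apply: vsq_Pop_gap => //; apply/ell2o_mean.
have : inner (edge_weight adj R) (l *: f) f =
    (sqnorm (edge_weight adj R) (Sop adj (Sop adj f)))%:C%C.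
  by rewrite -inner_sqnorm -Tf !Sadj_inner.
rewrite innerZl inner_sqnorm rmorphM /= fmorphV => <-.
by rewrite mulfK // fmorph_eq0 gt_eqF.
Qed.
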